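(* Let $n\in\mathbb N$ and let $(U_n(t))_{t\ge0}$ be the Brownian motion on the unitary group $U(n)$ started at the identity matrix $I_n$. For every unitary matrix $V\in U(n)$ and all $t\ge0$ and $z\in\mathbb C$ we have $$Q_n(z;t):=\mathbb E\det(zI_n-VU_n(t))=\det(zI_n-V)\boxtimes_n e^{-\frac12nt}H_n(e^{t/2}z;t).$$ Also, the following PDE holds: $$\partial_tQ_n(z;t)=-\frac12(z\partial_z+1)(n-z\partial_z)Q_n(z;t),\qquad Q_n(z;0)=\det(zI_n-V).$$
   Context: $U(n)$ is regarded as a compact Riemannian manifold with the Riemannian metric induced by its natural embedding into $\mathbb C^{n\times n}\equiv\mathbb R^{2n^2}$; on the Lie algebra $\mathfrak u(n)=\{A:A^*=-A\}$ the scalar product is $\langle A,B\rangle=\operatorname{Tr}(AB^* )=-\operatorname{Tr}(AB)$. Brownian motion is the diffusion whose generator is $\frac12$ times the Laplace--Beltrami operator. Unitary Hermite polynomials: for $n\in\mathbb N$ and $s\ge0$, $H_n(z;s)=\sum_{j=0}^n(-1)^{n-j}\binom nj \exp\{-\tfrac{s\,j(n-j)}{2}\}z^j$. Finite free multiplicative convolution: for polynomials in $z$ of degree at most $n$, $$\Big(\sum_{j=0}^n\alpha_jz^j\Big)\boxtimes_n\Big(\sum_{j=0}^n\beta_jz^j\Big)=\sum_{j=0}^n(-1)^{n-j}\frac{\alpha_j\beta_j}{\binom nj}z^j.$$ Here $\det(zI_n-V)$ and $e^{-nt/2}H_n(e^{t/2}z;t)$ are regarded as polynomials in $z$. *)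

(* Defs.v *)
From HB Require Import structures.
From mathcomp Require Import all_boot all_order all_algebra.
From mathcomp Require Import complex.
From mathcomp Require Import all_classical all_reals all_analysis.
From mathcomp Require Import ring lra zify.

Set Implicit Arguments.
Unset Strict Implicit.
Unset Printing Implicit Defensive.

Import Order.TTheory GRing.Theory Num.Theory.
Import numFieldNormedType.Exports.

Local Open Scope classical_set_scope.
Local Open Scope complex_scope.
Local Open Scope sesquilinear_scope.
Local Open Scope ring_scope.

Section Ambient.
Variables (R : realType) (n : nat).

(* The identification of C^(n x n) with R^(2n^2): real and imaginary parts. *)
Definition ambient : normedModType R := ('M[R]_n * 'M[R]_n)%type.

Definition realify (M : 'M[R[i]]_n) : ambient :=
  (map_mx (@complex.Re R) M, map_mx (@complex.Im R) M).

Definition complexify (x : ambient) : 'M[R[i]]_n :=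
  \matrix_(i, j) (x.1 i j +i* x.2 i j).

(* Tr (A B^* ) is real on u(n); on all of C^(n x n) its real part is the
   Euclidean scalar product of R^(2n^2). *)
Definition hs_dot (A B : 'M[R[i]]_n) : R := complex.Re (\tr (A *m B^t*)).

Definition euclid_dot (x y : ambient) : R :=
  hs_dot (complexify x) (complexify y).

Fixpoint differentiable_class (k : nat) (f : ambient -> R) : Prop :=
  match k with
  | 0 => continuous f
  | k'.+1 => continuous f /\
      forall v, (forall x, derivable f x v) /\
                differentiable_class k' (fun x => 'D_v f x)
  end.

Definition smooth (f : ambient -> R) : Prop :=
  forall k, differentiable_class k f.

(* An orthonormal basis of u(n), see skew_basis_skew, skew_basis_orthonormal. *)
Definition skew_basis (k : 'I_n * 'I_n) : 'M[R[i]]_n :=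
  let: (i, j) := k in
  if i == j then (0 +i* 1) *: delta_mx i i
  else if (i < j)%N then
    ((Num.sqrt 2)^-1 +i* 0) *: (delta_mx i j - delta_mx j i)
  else (0 +i* (Num.sqrt 2)^-1) *: (delta_mx i j + delta_mx j i).

(* Left translation by U in U(n) is a linear isometry of R^(2n^2) preserving
   U(n), so the U A, with A in an orthonormal basis of u(n), form an
   orthonormal basis of the tangent space at U. *)
Definition tangent_basis (x : ambient) (k : 'I_n * 'I_n) : ambient :=
  realify (complexify x *m skew_basis k).

(* Functions and vector fields on U(n) are given by extensions to the ambient
   space.  The values on U(n) of the operators below depend only on the
   restriction to U(n), since all derivatives are taken along tangent vectors.
   The Levi-Civita connection of U(n) being the tangential part of the ambient
   derivative, div W is the sum of the <D_e W, e> for e in an orthonormal basis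
   of the tangent space. *)
Definition gradient (f : ambient -> R) (x : ambient) : ambient :=
  \sum_k 'D_(tangent_basis x k) f x *: tangent_basis x k.

Definition divergence (W : ambient -> ambient) (x : ambient) : R :=
  \sum_k 'D_(tangent_basis x k)
           (fun y => euclid_dot (W y) (tangent_basis x k)) x.

Definition laplace_beltrami (f : ambient -> R) (x : ambient) : R :=
  divergence (gradient f) x.

End Ambient.

Section SkewBasis.
Variables (R : realType) (n : nat).
Implicit Types A B C : 'M[R[i]]_n.

Lemma hs_dotE A B :
  hs_dot A B = \sum_i \sum_j complex.Re (A i j * (B i j)^*%C).
Proof.
rewrite /hs_dot /mxtrace raddf_sum; apply: eq_bigr => i _.
by rewrite mxE raddf_sum; apply: eq_bigr => j _; rewrite !mxE.
Qed.

Lemma hs_dotDr A B C : hs_dot A (B + C) = hs_dot A B + hs_dot A C.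
Proof.
rewrite !hs_dotE -big_split; apply: eq_bigr => i _.
rewrite -big_split; apply: eq_bigr => j _.
by rewrite mxE rmorphD mulrDr raddfD.
Qed.

Lemma hs_dotBr A B C : hs_dot A (B - C) = hs_dot A B - hs_dot A C.
Proof.
rewrite -scaleN1r hs_dotDr !hs_dotE -sumrN; congr (_ + _).
apply: eq_bigr => i _; rewrite -sumrN; apply: eq_bigr => j _.
by rewrite mxE rmorphM rmorphN rmorph1 mulN1r mulrN raddfN.
Qed.

Lemma hs_dot_delta A c a b :
  hs_dot A (c *: delta_mx a b) = complex.Re (A a b * c^*%C).
Proof.
rewrite hs_dotE (bigD1 a) //= (bigD1 b) //= !mxE !eqxx mulr1.
rewrite big1 ?addr0 => [|j nj].
  rewrite big1 ?addr0 // => i ni; rewrite big1 // => j _.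
  by rewrite !mxE (negPf ni) mulr0 rmorph0 mulr0.
by rewrite !mxE (negPf nj) andbF mulr0 rmorph0 mulr0.
Qed.

Lemma skew_basis_skew (k : 'I_n * 'I_n) :
  (skew_basis R k)^t* = - skew_basis R k.
Proof.
case: k => i j /=; apply/matrixP => a b; rewrite (eq_sym i j).
have [<-|_] := eqVneq j i; [|case: ifP => _]; rewrite !mxE ?[in LHS]mxE;
  do ?case: eqVneq => ? /=; apply/eqP; rewrite eq_complex /=; apply/andP;
  split; apply/eqP; ring.
Qed.

Lemma skew_basis_orthonormal (k l : 'I_n * 'I_n) :
  hs_dot (skew_basis R k) (skew_basis R l) = (k == l)%:R.
Proof.
have s2 : (Num.sqrt (2 : R))^-1 ^+ 2 = 2^-1 by rewrite exprVn sqr_sqrtr.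
case: k l => i j [a b]; rewrite /= xpair_eqE.
move: s2; set r := (Num.sqrt 2)^-1; rewrite expr2 => s2.
rewrite -!val_eqE /=.
case: (ltngtP (nat_of_ord a) (nat_of_ord b)) => ab;
  set A := (X in hs_dot X _);
  rewrite 1?scalerDr ?scalerN ?hs_dotBr ?hs_dotDr !hs_dot_delta /A {A};
  case: (ltngtP (nat_of_ord i) (nat_of_ord j)) => ij;
  rewrite !mxE -!val_eqE /=.
all: case: (eqVneq (nat_of_ord i) (nat_of_ord a)) => [?|?].
all: case: (eqVneq (nat_of_ord j) (nat_of_ord b)) => [?|?].
all: rewrite ?(eq_sym (nat_of_ord a)) ?(eq_sym (nat_of_ord b)).
all: case: (eqVneq (nat_of_ord i) (nat_of_ord b)) => [?|?].
all: case: (eqVneq (nat_of_ord j) (nat_of_ord a)) => [?|?].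
all: try (exfalso; lia).
all: by rewrite /=; lra.
Qed.

End SkewBasis.

Section BrownianMotion.
Variables (R : realType) (d : measure_display) (Omega : measurableType d).
Variable P : probability Omega R.

Definition martingale (F : R -> set (set Omega)) (M : R -> Omega -> R) : Prop :=
  [/\ forall t, 0 <= t -> forall B, measurable B -> F t (M t @^-1` B),
      forall t, 0 <= t -> P.-integrable [set: Omega] (EFin \o M t) &
      forall s t A, 0 <= s -> s <= t -> F s A ->
        \int[P]_(w in A) M t w = \int[P]_(w in A) M s w].

Variable n : nat.
Implicit Type U : R -> Omega -> 'M[R[i]]_n.

Definition natural_filtration U (t : R) : set (set Omega) :=
  <<s [set A | exists r (O : set (ambient R n)),
        [/\ 0 <= r <= t, open O & A = (fun w => realify (U r w)) @^-1` O]] >>.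

Definition dynkin_process U (f : ambient R n -> R) (t : R) (w : Omega) : R :=
  f (realify (U t w)) - f (realify (U 0 w))
  - \int[@lebesgue_measure R]_(s in `[0, t])
      (2^-1 * laplace_beltrami f (realify (U s w))).

(* The diffusion generated by half the Laplace-Beltrami operator, as the
   solution of the martingale problem.  Every smooth function on the compact
   submanifold U(n) extends to a smooth function on the ambient space. *)
Record unitary_brownian_motion U : Prop := UnitaryBrownianMotion {
  ubm_measurable : forall t (O : set (ambient R n)), 0 <= t -> open O ->
    measurable ((fun w => realify (U t w)) @^-1` O);
  ubm_unitary : forall t w, 0 <= t -> U t w \is unitarymx;
  ubm_continuous : forall w,
    {within [set t : R | 0 <= t], continuous (fun t => realify (U t w))};
  ubm_martingale : forall f, smooth f ->
    martingale (natural_filtration U) (dynkin_process U f)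
}.

Definition complex_expectation (X : Omega -> R[i]) : R[i] :=
  fine 'E_P[fun w => complex.Re (X w)] +i* fine 'E_P[fun w => complex.Im (X w)].

Definition mean_det (V : 'M[R[i]]_n) U (z : R[i]) (t : R) : R[i] :=
  complex_expectation (fun w => \det (z%:M - V *m U t w)).

End BrownianMotion.

Section Polynomials.
Variable R : realType.

Definition hermite_unitary (n : nat) (s : R) : {poly R[i]} :=
  \poly_(j < n.+1) ((-1) ^+ (n - j) * 'C(n, j)%:R
                    * (expR (- (s * j%:R * (n - j)%:R / 2)))%:C).

Definition free_mul_conv (n : nat) (p q : {poly R[i]}) : {poly R[i]} :=
  \poly_(j < n.+1) ((-1) ^+ (n - j) * (p`_j * q`_j / 'C(n, j)%:R)).

(* The polynomial e^(-nt/2) H_n(e^(t/2) z; t) in z. *)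
Definition hermite_rescaled (n : nat) (t : R) : {poly R[i]} :=
  (expR (- (n%:R * t / 2)))%:C
    *: (hermite_unitary n t \Po ((expR (t / 2))%:C *: 'X)).

(* The operator z d/dz; R[i]^o carries the topology of R[i] as a numFieldType. *)
Definition euler_op (f : R[i] -> R[i]) (z : R[i]) : R[i] :=
  z * derive1 (f : R[i]^o -> R[i]^o) z.

(* l is the derivative at t of f restricted to [0, +oo[; it is the ordinary
   derivative for t > 0 and the right derivative for t = 0. *)
Definition is_derive_nonneg (f : R -> R[i]) (t : R) (l : R[i]) : Prop :=
  (fun h => (h^-1%:C * (f (t + h) - f t) : R[i]^o))
    @ within [set h | 0 <= t + h] (0^' : set_system R) --> (l : R[i]^o).

End Polynomials.

(* Main.v *)
(* By the Leibniz formula det (z - V U) is a combination, with coefficients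
   depending on z only, of the principal minors of V U. Left-invariant vector
   fields replace entries of Y = V U by entries of Y A, so the Casimir identity
   turns the second derivatives of a product of entries of Y into the same
   product with two column indices exchanged, which changes the sign of a minor.
   Hence a minor of size k is an eigenfunction of the Laplace-Beltrami operator
   for the eigenvalue - k (n - k + 1). The martingale property gives
   E f(U_t) = f(I) + (c / 2) int_0^t E f(U_s) ds for a bounded eigenfunction f
   with eigenvalue c, so E f(U_t) = f(I) exp (c t / 2). For k = n - j the factor
   exp (- (n - j) (j + 1) t / 2) is exp (- n t / 2) exp (j t / 2)
   exp (- t j (n - j) / 2), which is the one in e^(-nt/2) H_n(e^(t/2) z; t). *)
Require Import Defs.
From HB Require Import structures.
From mathcomp Require Import all_boot all_order all_algebra.
From mathcomp Require Import all_fingroup.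
From mathcomp Require Import complex.
From mathcomp Require Import all_classical all_reals all_analysis.
From mathcomp Require Import ring lra.

Set Implicit Arguments.
Unset Strict Implicit.
Unset Printing Implicit Defensive.

Import Order.TTheory GRing.Theory Num.Theory.
Import numFieldNormedType.Exports.

Local Open Scope classical_set_scope.
Local Open Scope complex_scope.
Local Open Scope ring_scope.

(** * Expansion of the determinant into principal minors *)

(* The Leibniz formula for the principal minor of M on S: the permutations of S
   are those of 'I_n supported in S, so that no submatrix is needed. *)
Definition pminor (T : comNzRingType) n (S : {set 'I_n}) (M : 'M[T]_n) : T :=
  \sum_(s : 'S_n | perm_on S s) (-1) ^+ s * \prod_(i in S) M i (s i).

(** Multiply out the Leibniz product: [S] is the set of rows where the entry of [- M] is chosen. The
    other rows contribute [z] if fixed by [s] and 0 otherwise, so only permutations supported in [S]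
    survive. *)
Lemma det_scalar_sub (T : comNzRingType) n (z : T) (M : 'M[T]_n) :
  \det (z%:M - M) =
  \sum_(S : {set 'I_n}) (-1) ^+ #|S| * z ^+ (n - #|S|) * pminor S M.
Proof.
rewrite /determinant.
under eq_bigr => s _.
  under eq_bigr => i _ do rewrite !mxE addrC.
  rewrite bigA_distr mulr_sumr.
  over.
rewrite exchange_big; apply: eq_bigr => S _; rewrite /pminor mulr_sumr.
rewrite [RHS]big_mkcond; apply: eq_bigr => s _.
rewrite (bigID [pred i | i \in S]) /=.
rewrite (eq_bigr (fun i => - M i (s i)))/=; last by move=> i ->.
rewrite [X in _ * (_ * X) = _](eq_bigr (fun i => z *+ (i == s i))); last first.
  by move=> i /negPf ->.
rewrite prodrN; case: ifP => [sS|/negbT sS].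
  rewrite [X in _ * (_ * X) = _](eq_bigr (fun=> z)) => [|i iS]; last first.
    by rewrite (out_perm sS) // eqxx.
  rewrite prodr_const.
  have -> : #|[pred i | i \notin S]| = (n - #|S|)%N.
    have := cardC (mem S); rewrite card_ord => nE.
    by rewrite -[X in (X - _)%N]nE addKn.
  rewrite mulrCA -!mulrA; congr (_ * _).
  by rewrite mulrCA [RHS]mulrCA; congr (_ * _); exact: mulrC.
(* A permutation not supported in [S] moves some [i] outside [S], and the off-diagonal entry of
   [z%:M] there kills the product. *)
case: (pickP [pred i | (i \notin S) && (s i != i)]) => [i /andP[iS si]|none].
  by rewrite [X in _ * (_ * X)](bigD1 i) //= eq_sym (negPf si) !(mulr0, mul0r).
case/negP: sS; apply/fintype.subsetP => i; rewrite inE => si.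
by have := none i; rewrite /= si andbT => /negbFE.
Qed.

(** * The Casimir element of u(n) acting on principal minors *)

Section Casimir.
Variables (R : realType) (n : nat).
Local Notation A := (skew_basis (n := n) R).

(* The Casimir identity: since gl_n(C) is the complexification of u(n) and the
   scalar product is - Tr (A B), the tensor sum_k A_k (x) A_k equals
   - sum_(i, j) E_ij (x) E_ji. *)
Lemma sum_skew_basis_tensor (a b c d : 'I_n) :
  \sum_k A k a b * A k c d = - ((a == d) && (b == c))%:R.
Proof.
pose r : R := (Num.sqrt 2)^-1.
have r2 : r * r = 2^-1 by rewrite -expr2 exprVn sqr_sqrtr.
(* At most two basis elements have a nonzero entry at [(a, b)], so the sum over [k] reduces to one
   term on the diagonal and two off it. *)
have A0 k : k != (a, b) -> k != (b, a) -> A k a b = 0.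
  case: k => p q; rewrite !xpair_eqE => n1 n2.
  have e1 : (a == p) && (b == q) = false.
    by rewrite (eq_sym a) (eq_sym b); exact: negPf.
  have e2 : (a == q) && (b == p) = false.
    by rewrite (eq_sym a) (eq_sym b) andbC; exact: negPf.
  rewrite /skew_basis; case: eqVneq => pq.
    by rewrite !mxE; rewrite pq in e1 *; rewrite e1 mulr0.
  by case: ifP; rewrite !mxE e1 e2 ?subrr ?addr0 mulr0.
case: (eqVneq a b) => [ab|ab].
  subst b; rewrite (bigD1 (a, a)) //= big1 ?addr0; last first.
    by move=> k nk; rewrite A0 ?mul0r.
  rewrite eqxx !mxE !eqxx mulr1 (eq_sym a d) (eq_sym a c) andbC.
  by case: (c == a); case: (d == a); apply/eqP; rewrite eq_complex /=; apply/andP;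
    split; apply/eqP; ring.
have abba : (b, a) != (a, b) by rewrite xpair_eqE (eq_sym b) negb_and ab.
rewrite (bigD1 (a, b)) // (bigD1 (b, a)) //= big1 ?addr0; last first.
  by move=> k /andP[n1 n2]; rewrite A0 ?mul0r.
rewrite (eq_sym b a) (negPf ab) (eq_sym a d) (eq_sym b c).
have := ab; rewrite -val_eqE /= neq_ltn => /orP[] lt.
  rewrite lt ltnNge (ltnW lt) /= !mxE !eqxx (negPf ab) (eq_sym b a) (negPf ab) /=.
  rewrite -/r; do ?case: eqVneq => _ /=;
  by apply/eqP; rewrite eq_complex /=; apply/andP; split; apply/eqP; lra.
rewrite lt ltnNge (ltnW lt) /= !mxE !eqxx (negPf ab) (eq_sym b a) (negPf ab) /=.
by rewrite -/r; do ?case: eqVneq => _ /=;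
  apply/eqP; rewrite eq_complex /=; apply/andP; split; apply/eqP; lra.
Qed.

Lemma sum_skew_basis_sqr : \sum_k A k *m A k = - (n%:R%:M).
Proof.
apply/matrixP => a d; rewrite summxE !mxE.
under eq_bigr => k _ do rewrite mxE.
rewrite exchange_big /=.
under eq_bigr => b _ do rewrite sum_skew_basis_tensor eqxx andbT.
by rewrite sumr_const card_ord; case: (a == d); rewrite ?mulr1n ?mulr0n
  ?oppr0 ?mul0rn // mulNrn.
Qed.

Lemma sum_mulmx_skew_basis (Y : 'M[R[i]]_n) (a b c d : 'I_n) :
  \sum_k (Y *m A k) a b * (Y *m A k) c d = - (Y a d * Y c b).
Proof.
under eq_bigr => k _ do rewrite !mxE big_distrlr.
rewrite exchange_big /=.
under eq_bigr => p _.
  rewrite exchange_big /=.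
  under eq_bigr => q _.
    under eq_bigr => k _ do rewrite mulrACA.
    rewrite -mulr_sumr sum_skew_basis_tensor.
    over.
  over.
rewrite (bigD1 d) //= (bigD1 b) //= !eqxx mulrN1 !big1 ?addr0 //.
  move=> p nd; rewrite big1 // => q _.
  by rewrite (negPf nd) oppr0 mulr0.
by move=> q nb; rewrite /= eq_sym (negPf nb) oppr0 mulr0.
Qed.

(** Reindexing by [s |-> tperm b b' * s] undoes the exchange of columns and flips the signature,
    while supports in [S] are preserved. *)
Lemma pminor_swap (Y : 'M[R[i]]_n) (S : {set 'I_n}) (b b' : 'I_n) :
  b \in S -> b' \in S :\ b ->
  \sum_(s : 'S_n | perm_on S s) (-1) ^+ s *
    (Y b (s b') * Y b' (s b) * \prod_(i in S :\ b :\ b') Y i (s i)) =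
  - pminor S Y.
Proof.
move=> bS /[dup] b'Sb; rewrite !inE => /andP[b'b b'S].
rewrite /pminor -sumrN.
have tS : perm_on S (tperm b b').
  apply/fintype.subsetP => i; rewrite inE; apply: contraNT => iS.
  by rewrite tpermD //; apply: contraNneq iS => <-.
rewrite (reindex_inj (mulgI (tperm b b'))) /=; apply: eq_big => [s|s].
  apply/idP/idP => h; last exact: perm_onM.
  by rewrite -[s](mulKg (tperm b b')) tpermV perm_onM.
move=> _; rewrite odd_mul_tperm eq_sym b'b /= signrN mulNr.
rewrite !permM tpermL tpermR [\prod_(i in S) _](big_setD1 b) //=
  [\prod_(i in S :\ b) _](big_setD1 b') //= mulrA.
congr (- (_ * (_ * _))); apply: eq_bigr => i; rewrite !inE => /and3P[ib' ib _].
by rewrite permM tpermD // eq_sym.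
Qed.

(** The left side is the product rule for the second derivatives of a minor along the fields
    [Y *m A k]. Differentiating row [b] twice gives [- n]; differentiating rows [b] and [b'] gives
    minus an exchange of columns, hence plus the minor by antisymmetry. Each [b] thus contributes
    [- n + (#|S| - 1)]. *)
Lemma casimir_pminor (Y : 'M[R[i]]_n) (S : {set 'I_n}) :
  \sum_k \sum_(s : 'S_n | perm_on S s) (-1) ^+ s *
    \sum_(b in S)
      ((Y *m (A k *m A k)) b (s b) * \prod_(i in S :\ b) Y i (s i) +
       (Y *m A k) b (s b) *
       \sum_(b' in S :\ b)
         (Y *m A k) b' (s b') * \prod_(i in S :\ b :\ b') Y i (s i)) =
  - (#|S| * (n - #|S|).+1)%:R * pminor S Y.
Proof.
rewrite exchange_big /=.
transitivity (\sum_(s : 'S_n | perm_on S s) (-1) ^+ s *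
   (\sum_(b in S) (- n%:R * \prod_(i in S) Y i (s i) -
    \sum_(b' in S :\ b) Y b (s b') * Y b' (s b) *
       \prod_(i in S :\ b :\ b') Y i (s i)))).
  apply: eq_bigr => s _; rewrite -mulr_sumr exchange_big /=; congr (_ * _).
  apply: eq_bigr => b bS; rewrite big_split /=; congr (_ + _).
    rewrite -mulr_suml -summxE -mulmx_sumr sum_skew_basis_sqr mulmxN.
    by rewrite mul_mx_scalar !mxE -mulNr -mulrA [in RHS](big_setD1 b).
  under eq_bigr => k _ do rewrite mulr_sumr.
  rewrite exchange_big /= -sumrN; apply: eq_bigr => b' b'S.
  under eq_bigr => k _ do rewrite mulrA.
  by rewrite -mulr_suml sum_mulmx_skew_basis mulNr.
have -> : - (#|S| * (n - #|S|).+1)%:R * pminor S Y =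
    \sum_(b in S) (- n%:R * pminor S Y +
      \sum_(b' in S :\ b) pminor S Y).
  rewrite [RHS](eq_bigr (fun=> - n%:R * pminor S Y +
    pminor S Y *+ #|S|.-1)); last first.
    by move=> b bS; rewrite sumr_const (cardsD1 b S) bS.
  rewrite sumr_const -[pminor S Y *+ _]mulr_natl -[RHS]mulr_natl.
  have := max_card (mem S); rewrite card_ord.
  (* The empty minor is split off because [#|S|.-1] is a truncated predecessor. *)
  case: #|S| => [|m] mn; first by rewrite mul0n oppr0 !mul0r.
  rewrite /= natrM -[(n - _).+1]addn1 natrD natrB // -[m.+1]addn1 natrD.
  by ring.
under eq_bigr => s _ do rewrite mulr_sumr.
rewrite exchange_big /=; apply: eq_bigr => b bS.
under eq_bigr => s _ do rewrite mulrBr mulrCA mulr_sumr.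
rewrite big_split /= -mulr_sumr; congr (_ + _).
rewrite sumrN exchange_big /= -sumrN; apply: eq_bigr => b' b'S.
by rewrite pminor_swap // opprK.
Qed.

End Casimir.

(** * Directional derivatives and smoothness of complex-valued functions on the ambient space *)

Section ComplexRe.
Variable R : realType.
Implicit Types z w : R[i].

Lemma complex_ReM z w : complex.Re (z * w) =
  complex.Re z * complex.Re w - complex.Im z * complex.Im w.
Proof. by case: z w => a b [c d]. Qed.

Lemma complex_ImM z w : complex.Im (z * w) =
  complex.Re z * complex.Im w + complex.Im z * complex.Re w.
Proof. by case: z w => a b [c d]. Qed.

End ComplexRe.

Section Calculus.
Variables (R : realType) (n : nat).
Local Notation E := (ambient R n).
Implicit Types (x v : E) (F G : E -> R[i]).

Lemma realifyK : cancel (@realify R n) (@complexify R n).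
Proof. by move=> M; apply/matrixP => i j; rewrite !mxE; case: (M i j). Qed.

Lemma complexifyD x v :
  complexify (x + v) = complexify x + complexify v :> 'M[R[i]]_n.
Proof. by apply/matrixP => i j; rewrite !mxE. Qed.

Lemma complexifyZ (a : R) x :
  complexify (a *: x) = a%:C *: complexify x :> 'M[R[i]]_n.
Proof.
by apply/matrixP => i j; rewrite !mxE; apply/eqP; rewrite eq_complex /= !mul0r;
  rewrite subr0 addr0 !eqxx.
Qed.

Lemma is_derive_affine (f : E -> R) x v (l : R) :
  (forall h : R, f (h *: v + x) = f x + h * l) -> is_derive x v f l.
Proof.
move=> fE.
have fl : h^-1 *: ((f \o shift x) (h *: v) - f x) @[h --> 0^'] --> l.
  apply: cvg_near_cst; rewrite near_withinE; apply: nearW => h h0 /=.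
  by rewrite fE addrAC subrr add0r scalerA mulVf // scale1r.
by split; [apply/cvg_ex; exists l|exact/cvg_lim].
Qed.

(** Componentwise, since [ambient] is a normed module over [R] and the derivatives along its vectors
    are real. *)
Definition cderive F x v (l : R[i]) : Prop :=
  is_derive x v (@complex.Re R \o F) (complex.Re l) /\
  is_derive x v (@complex.Im R \o F) (complex.Im l).

Lemma cderive_eq F x v l l' : cderive F x v l -> l = l' -> cderive F x v l'.
Proof. by move=> ? <-. Qed.

Lemma cderive_cst (k : R[i]) x v : cderive (fun=> k) x v 0.
Proof. by split; exact: is_derive_cst. Qed.

Lemma cderiveD F G x v l m : cderive F x v l -> cderive G x v m ->
  cderive (fun y => F y + G y) x v (l + m).
Proof.
move=> [Fr Fi] [Gr Gi]; split; rewrite raddfD.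
- have -> : @complex.Re R \o (fun y => F y + G y) =
      (@complex.Re R \o F) + (@complex.Re R \o G).
    by apply/funext => y /=; rewrite raddfD.
  exact: is_deriveD.
- have -> : @complex.Im R \o (fun y => F y + G y) =
      (@complex.Im R \o F) + (@complex.Im R \o G).
    by apply/funext => y /=; rewrite raddfD.
  exact: is_deriveD.
Qed.

Lemma cderiveM F G x v l m : cderive F x v l -> cderive G x v m ->
  cderive (fun y => F y * G y) x v (l * G x + F x * m).
Proof.
move=> [Fr Fi] [Gr Gi]; split.
- have -> : @complex.Re R \o (fun y => F y * G y) =
      (@complex.Re R \o F) * (@complex.Re R \o G) -
      (@complex.Im R \o F) * (@complex.Im R \o G).
    by apply/funext => y /=; rewrite complex_ReM.
  apply: is_derive_eq (is_deriveB (is_deriveM Fr Gr) (is_deriveM Fi Gi)) _.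
  rewrite [in RHS]raddfD /= !complex_ReM /GRing.scale /=.
  by ring.
- have -> : @complex.Im R \o (fun y => F y * G y) =
      (@complex.Re R \o F) * (@complex.Im R \o G) +
      (@complex.Im R \o F) * (@complex.Re R \o G).
    by apply/funext => y /=; rewrite complex_ImM.
  apply: is_derive_eq (is_deriveD (is_deriveM Fr Gi) (is_deriveM Fi Gr)) _.
  rewrite [in RHS]raddfD /= !complex_ImM /GRing.scale /=.
  by ring.
Qed.

Lemma cderiveMl (k : R[i]) F x v l :
  cderive F x v l -> cderive (fun y => k * F y) x v (k * l).
Proof.
move=> dF; apply: cderive_eq (cderiveM (cderive_cst k x v) dF) _.
by rewrite mul0r add0r.
Qed.

Lemma cderive_sum (I : Type) (r : seq I) (p : pred I) (F : I -> E -> R[i])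
    x v (l : I -> R[i]) :
  (forall i, p i -> cderive (F i) x v (l i)) ->
  cderive (fun y => \sum_(i <- r | p i) F i y) x v (\sum_(i <- r | p i) l i).
Proof.
move=> dF; elim: r => [|i r ih].
  rewrite big_nil; under eq_fun do rewrite big_nil.
  exact: cderive_cst.
rewrite big_cons; under eq_fun do rewrite big_cons.
case: ifP => // pi.
by apply: cderiveD => //; exact: dF.
Qed.

Lemma cderive_prod (I : finType) (S : {set I}) (F : I -> E -> R[i])
    x v (l : I -> R[i]) :
  (forall i, cderive (F i) x v (l i)) ->
  cderive (fun y => \prod_(i in S) F i y) x v
    (\sum_(b in S) l b * \prod_(i in S :\ b) F i x).
Proof.
(* Induction on a bound for the cardinality: one factor [a] is split off and the rest is a product
   over [S :\ a]. *)
move=> dF; have [m] := ubnP #|S|; elim: m S => // m IH S.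
have [->|[a aS]] := set_0Vmem S => [_|Sm].
  rewrite big_set0; under eq_fun do rewrite big_set0.
  exact: cderive_cst.
under eq_fun do rewrite (big_setD1 a aS) /=.
apply: cderive_eq (cderiveM (dF a) (IH (S :\ a) _)) _.
  by move: Sm; rewrite (cardsD1 a) aS.
rewrite [RHS](big_setD1 a aS) /=; congr (_ + _).
rewrite mulr_sumr; apply: eq_bigr => b; rewrite !inE => /andP[ba bS].
rewrite [in RHS](big_setD1 a) ?inE ?aS ?andbT 1?eq_sym // mulrCA.
congr (_ * (_ * _)); apply: eq_bigl => i; rewrite !inE.
by rewrite andbCA.
Qed.

Lemma cderive_mulmx (V A : 'M[R[i]]_n) (a b : 'I_n) x v :
  cderive (fun y => (V *m complexify y *m A) a b) x v
    ((V *m complexify v *m A) a b).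
Proof.
have affine (h : R) : (V *m complexify (h *: v + x) *m A) a b =
    (V *m complexify x *m A) a b + h%:C * (V *m complexify v *m A) a b.
  rewrite complexifyD complexifyZ mulmxDr mulmxDl -scalemxAr -scalemxAl.
  by rewrite mxE [X in X + _]mxE addrC.
have Re_affine (z w : R[i]) (h : R) :
    complex.Re (z + h%:C * w) = complex.Re z + h * complex.Re w.
  by case: z w => p q [p' q'] /=; rewrite mul0r subr0.
have Im_affine (z w : R[i]) (h : R) :
    complex.Im (z + h%:C * w) = complex.Im z + h * complex.Im w.
  by case: z w => p q [p' q'] /=; rewrite mul0r addr0.
by split; apply: is_derive_affine => h; rewrite [LHS]/comp affine
  ?Re_affine ?Im_affine.
Qed.

(** A class of continuous functions closed under directional derivatives, so that [smooth] follows
    by induction on the order. *)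
Inductive coordinate_polynomial : (E -> R) -> Prop :=
| coordinate_polynomial_cst c : coordinate_polynomial (fun=> c)
| coordinate_polynomial_re i j : coordinate_polynomial (fun x => x.1 i j)
| coordinate_polynomial_im i j : coordinate_polynomial (fun x => x.2 i j)
| coordinate_polynomialD f g : coordinate_polynomial f ->
    coordinate_polynomial g -> coordinate_polynomial (fun x => f x + g x)
| coordinate_polynomialM f g : coordinate_polynomial f ->
    coordinate_polynomial g -> coordinate_polynomial (fun x => f x * g x).

Lemma coordinate_polynomial_continuous f :
  coordinate_polynomial f -> continuous f.
Proof.
elim=> {f} [c|i j|i j|f g _ cf _ cg|f g _ cf _ cg] x.
- exact: cvg_cst.
- apply: (@cvg_comp _ _ _ fst (fun M : 'M[R]_n => M i j)); first exact: cvg_fst.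
  exact: coord_continuous.
- apply: (@cvg_comp _ _ _ snd (fun M : 'M[R]_n => M i j)); first exact: cvg_snd.
  exact: coord_continuous.
- by apply: cvgD; [exact: cf|exact: cg].
- by apply: cvgM; [exact: cf|exact: cg].
Qed.

Lemma coordinate_polynomial_derive f v : coordinate_polynomial f ->
  exists2 g, coordinate_polynomial g & forall x, is_derive x v f (g x).
Proof.
elim=> {f} [c|i j|i j|f g pf [f' pf' df] pg [g' pg' dg]
           |f g pf [f' pf' df] pg [g' pg' dg]].
- exists (fun=> 0); first exact: coordinate_polynomial_cst.
  by move=> x; exact: is_derive_cst.
- exists (fun=> v.1 i j); first exact: coordinate_polynomial_cst.
  by move=> x; apply: is_derive_affine => h; rewrite !mxE addrC.
- exists (fun=> v.2 i j); first exact: coordinate_polynomial_cst.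
  by move=> x; apply: is_derive_affine => h; rewrite !mxE addrC.
- exists (fun x => f' x + g' x); first exact: coordinate_polynomialD.
  by move=> x; exact: is_deriveD.
- exists (fun x => f x * g' x + g x * f' x).
    by apply: coordinate_polynomialD; exact: coordinate_polynomialM.
  by move=> x; exact: is_deriveM.
Qed.

Lemma coordinate_polynomial_smooth f : coordinate_polynomial f -> smooth f.
Proof.
move=> pf k; elim: k f pf => [|k IH] f pf /=.
  exact: coordinate_polynomial_continuous.
split=> [|v]; first exact: coordinate_polynomial_continuous.
have [g pg dg] := coordinate_polynomial_derive v pf.
split=> [x|]; first by have [] := dg x.
have -> : (fun x => 'D_v f x) = g by apply/funext => x; exact: derive_val.
exact: IH.
Qed.

Definition complex_polynomial F : Prop :=
  coordinate_polynomial (@complex.Re R \o F) /\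
  coordinate_polynomial (@complex.Im R \o F).

Lemma complex_polynomial_cst k : complex_polynomial (fun=> k).
Proof. by split; exact: coordinate_polynomial_cst. Qed.

Lemma complex_polynomialD F G : complex_polynomial F -> complex_polynomial G ->
  complex_polynomial (fun y => F y + G y).
Proof.
move=> [Fr Fi] [Gr Gi]; split.
- have -> : @complex.Re R \o (fun y => F y + G y) =
      (fun y => (@complex.Re R \o F) y + (@complex.Re R \o G) y).
    by apply/funext => y /=; rewrite raddfD.
  exact: coordinate_polynomialD.
- have -> : @complex.Im R \o (fun y => F y + G y) =
      (fun y => (@complex.Im R \o F) y + (@complex.Im R \o G) y).
    by apply/funext => y /=; rewrite raddfD.
  exact: coordinate_polynomialD.
Qed.

Lemma complex_polynomialM F G : complex_polynomial F -> complex_polynomial G ->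
  complex_polynomial (fun y => F y * G y).
Proof.
move=> [Fr Fi] [Gr Gi]; split.
- have -> : @complex.Re R \o (fun y => F y * G y) =
      (fun y => (@complex.Re R \o F) y * (@complex.Re R \o G) y +
         -1 * ((@complex.Im R \o F) y * (@complex.Im R \o G) y)).
    by apply/funext => y /=; rewrite complex_ReM mulN1r.
  apply: coordinate_polynomialD; first exact: coordinate_polynomialM.
  apply: coordinate_polynomialM; first exact: coordinate_polynomial_cst.
  exact: coordinate_polynomialM.
- have -> : @complex.Im R \o (fun y => F y * G y) =
      (fun y => (@complex.Re R \o F) y * (@complex.Im R \o G) y +
                (@complex.Im R \o F) y * (@complex.Re R \o G) y).
    by apply/funext => y /=; rewrite complex_ImM.
  by apply: coordinate_polynomialD; exact: coordinate_polynomialM.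
Qed.

Lemma complex_polynomial_sum (I : Type) (r : seq I) (p : pred I)
    (F : I -> E -> R[i]) : (forall i, complex_polynomial (F i)) ->
  complex_polynomial (fun y => \sum_(i <- r | p i) F i y).
Proof.
move=> pF; elim: r => [|i r ih].
  under eq_fun do rewrite big_nil.
  exact: complex_polynomial_cst.
under eq_fun do rewrite big_cons.
by case: (p i) => //; exact: complex_polynomialD.
Qed.

Lemma complex_polynomial_prod (I : Type) (r : seq I) (p : pred I)
    (F : I -> E -> R[i]) : (forall i, complex_polynomial (F i)) ->
  complex_polynomial (fun y => \prod_(i <- r | p i) F i y).
Proof.
move=> pF; elim: r => [|i r ih].
  under eq_fun do rewrite big_nil.
  exact: complex_polynomial_cst.
under eq_fun do rewrite big_cons.
by case: (p i) => //; exact: complex_polynomialM.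
Qed.

Lemma complex_polynomial_mulmx (V : 'M[R[i]]_n) (a b : 'I_n) :
  complex_polynomial (fun y => (V *m complexify y) a b).
Proof.
under eq_fun do rewrite mxE.
apply: complex_polynomial_sum => i; apply: complex_polynomialM.
  exact: complex_polynomial_cst.
split.
- have -> : @complex.Re R \o (fun y : E => complexify y i b) = (fun y => y.1 i b).
    by apply/funext => y /=; rewrite mxE.
  exact: coordinate_polynomial_re.
- have -> : @complex.Im R \o (fun y : E => complexify y i b) = (fun y => y.2 i b).
    by apply/funext => y /=; rewrite mxE.
  exact: coordinate_polynomial_im.
Qed.

(** The martingale problem is tested on real functions. The factor [k] carries the coefficients in
    [z], and a factor [- 'i] in it gives access to imaginary parts. *)
Definition re_pminor (k : R[i]) (V : 'M[R[i]]_n) (S : {set 'I_n}) (y : E) : R :=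
  complex.Re (k * pminor S (V *m complexify y)).

Lemma re_pminor_smooth k V S : smooth (re_pminor k V S).
Proof.
apply: coordinate_polynomial_smooth.
suff [] : complex_polynomial (fun y => k * pminor S (V *m complexify y)) by [].
apply: complex_polynomialM; first exact: complex_polynomial_cst.
apply: complex_polynomial_sum => s; apply: complex_polynomialM.
  exact: complex_polynomial_cst.
by apply: complex_polynomial_prod => i; exact: complex_polynomial_mulmx.
Qed.

End Calculus.

(** * Principal minors as eigenfunctions of the Laplace-Beltrami operator *)

Section Laplacian.
Local Open Scope sesquilinear_scope.
Variables (R : realType) (n : nat).
Local Notation E := (ambient R n).
Local Notation A := (skew_basis (n := n) R).
Lemma hs_dotC (B C : 'M[R[i]]_n) : hs_dot B C = hs_dot C B.
Proof.
rewrite !hs_dotE; apply: eq_bigr => i _; apply: eq_bigr => j _.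
by case: (B i j) (C i j) => a b [c d] /=; ring.
Qed.

Lemma hs_dotZr (a : R) (B C : 'M[R[i]]_n) :
  hs_dot B (a%:C *: C) = a * hs_dot B C.
Proof.
rewrite !hs_dotE mulr_sumr; apply: eq_bigr => i _.
rewrite mulr_sumr; apply: eq_bigr => j _; rewrite mxE.
by case: (B i j) (C i j) => p q [c d] /=; ring.
Qed.

Lemma hs_dot0r (B : 'M[R[i]]_n) : hs_dot B 0 = 0.
Proof.
by rewrite -[X in hs_dot _ X](scale0r (0 : 'M[R[i]]_n)) (hs_dotZr 0) mul0r.
Qed.

Lemma euclid_dot_sumZl (I : finType) (a : I -> R) (e : I -> E) (x : E) :
  euclid_dot (\sum_l a l *: e l) x = \sum_l a l * euclid_dot (e l) x.
Proof.
rewrite /euclid_dot; elim/big_ind2: _ => [|y1 s1 y2 s2 <- <-|l _].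
- have -> : complexify (0 : E) = 0 :> 'M[R[i]]_n.
    by rewrite -[X in complexify X](scale0r 0) complexifyZ scale0r.
  by rewrite hs_dotC hs_dot0r.
- by rewrite complexifyD hs_dotC hs_dotDr !(hs_dotC (complexify x)).
- by rewrite complexifyZ hs_dotC hs_dotZr hs_dotC.
Qed.

Lemma hs_dot_unitary (M B C : 'M[R[i]]_n) : M \is unitarymx ->
  hs_dot (M *m B) (M *m C) = hs_dot B C.
Proof.
move=> Mu; rewrite /hs_dot; congr complex.Re.
rewrite trmx_mul map_mxM !mulmxA mxtrace_mulC !mulmxA.
by rewrite -(invmx_unitary Mu) mulVmx ?unitarymx_unit // mul1mx.
Qed.

(** Taking adjoints inside the trace reverses the sign. This is what makes left-invariant fields
    divergence free, so the Laplacian has no first-order term in the frame. *)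
Lemma hs_dot_mul_skew (B C : 'M[R[i]]_n) :
  B^t* = - B -> C^t* = - C -> hs_dot (B *m C) B = 0.
Proof.
move=> Bs Cs.
have e : hs_dot (B *m C) B = - hs_dot (B *m C) B.
  rewrite {1}hs_dotC /hs_dot trmx_mul map_mxM Bs Cs.
  by rewrite mulNmx !mulmxN opprK mulmxA !raddfN /= opprK.
by move: e; lra.
Qed.

Lemma is_derive_bigsum (I : Type) (r : seq I) (h : I -> E -> R) x v dh :
  (forall i, is_derive x v (h i) (dh i)) ->
  is_derive x v (fun y => \sum_(i <- r) h i y) (\sum_(i <- r) dh i).
Proof.
move=> dhP; elim: r => [|i r ih].
  by rewrite big_nil; under eq_fun do rewrite big_nil; exact: is_derive_cst.
rewrite big_cons; under eq_fun do rewrite big_cons.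
exact: is_deriveD.
Qed.

Variables (k : R[i]) (V : 'M[R[i]]_n) (S : {set 'I_n}).
Local Notation Y y := (V *m complexify y).

(** [df B] is the derivative of the minor along the field [y |-> y B], and [d2f B v] the derivative
    of [df B] in the direction [v], both in the form met in [casimir_pminor]. *)
Let df (B : 'M[R[i]]_n) (y : E) : R[i] :=
  k * \sum_(s : 'S_n | perm_on S s) (-1) ^+ s * \sum_(b in S)
    (Y y *m B) b (s b) * \prod_(i in S :\ b) Y y i (s i).

Let d2f (B : 'M[R[i]]_n) (v y : E) : R[i] :=
  k * \sum_(s : 'S_n | perm_on S s) (-1) ^+ s * \sum_(b in S)
    ((Y v *m B) b (s b) * \prod_(i in S :\ b) Y y i (s i) +
     (Y y *m B) b (s b) * \sum_(b' in S :\ b)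
        Y v b' (s b') * \prod_(i in S :\ b :\ b') Y y i (s i)).

Let cderive_Y (a b : 'I_n) (x v : E) :
  cderive (fun y => Y y a b) x v ((Y v) a b).
Proof.
have := cderive_mulmx V 1%:M a b x v; rewrite mulmx1.
by under eq_fun do rewrite mulmx1.
Qed.

Let cderive_pminor (B : 'M[R[i]]_n) (y : E) :
  cderive (fun y => k * pminor S (Y y)) y (realify (complexify y *m B)) (df B y).
Proof.
apply: cderiveMl; apply: cderive_sum => s _; apply: cderiveMl.
have := @cderive_prod _ _ _ S (fun i y => Y y i (s i)) y
  (realify (complexify y *m B)) _ (fun i => cderive_Y i (s i) y _).
by under eq_bigr do rewrite realifyK mulmxA.
Qed.

Let cderive_df (B : 'M[R[i]]_n) (v y : E) : cderive (df B) y v (d2f B v y).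
Proof.
apply: cderiveMl; apply: cderive_sum => s _; apply: cderiveMl.
apply: cderive_sum => b bS; apply: cderiveM; first exact: cderive_mulmx.
exact: (@cderive_prod _ _ _ (S :\ b) (fun i y => Y y i (s i))).
Qed.

(** At a unitary [x] the frame is orthonormal and its fields are divergence free, so only the pure
    second derivatives remain, and the Casimir computation sums them. *)
Lemma laplace_beltrami_re_pminor (x : E) : complexify x \is unitarymx ->
  laplace_beltrami (re_pminor k V S) x =
  - (#|S| * (n - #|S|).+1)%:R * re_pminor k V S x.
Proof.
move=> xu; pose f := re_pminor k V S.
have gE y : gradient f y =
    \sum_l complex.Re (df (A l) y) *: tangent_basis y l.
  apply: eq_bigr => l _; congr (_ *: _).
  have [[_ d] _] := cderive_pminor (A l) y; exact: d.
have dotE (y z : E) l j : euclid_dot (tangent_basis y l) (tangent_basis z j) =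
    hs_dot (complexify y *m A l) (complexify z *m A j).
  by rewrite /euclid_dot /tangent_basis !realifyK.
rewrite /laplace_beltrami /divergence.
transitivity (\sum_j complex.Re (d2f (A j) (tangent_basis x j) x)).
  apply: eq_bigr => j _.
  have -> : (fun y => euclid_dot (gradient f y) (tangent_basis x j)) =
    (fun y => \sum_l complex.Re (df (A l) y) *
            euclid_dot (tangent_basis y l) (tangent_basis x j)).
    by apply/funext => y; rewrite gE euclid_dot_sumZl.
  pose t := tangent_basis x j.
  have -> : complex.Re (d2f (A j) t x) =
      \sum_l (l == j)%:R * complex.Re (d2f (A l) t x).
    rewrite (bigD1 j) //= eqxx mul1r big1 ?addr0 // => l /negPf ->.
    by rewrite mul0r.
  apply: derive_val; apply: is_derive_bigsum => l.
  have [d1 _] := cderive_df (A l) t x.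
  (* With [x] unitary this derivative is the scalar product of [A j *m A l] with [A j], which
     vanishes by skewness. *)
  have d2 : is_derive x t (fun y => euclid_dot (tangent_basis y l) t) 0.
    apply: is_derive_affine => h; rewrite mulr0 addr0 !dotE.
    rewrite complexifyD complexifyZ mulmxDl -scalemxAl.
    rewrite hs_dotC hs_dotDr hs_dotZr hs_dotC realifyK -mulmxA.
    rewrite hs_dot_unitary // hs_dot_mul_skew ?skew_basis_skew //.
    by rewrite mulr0 add0r hs_dotC.
  apply: is_derive_eq (is_deriveM d1 d2) _.
  rewrite scaler0 add0r dotE hs_dot_unitary // skew_basis_orthonormal.
  by [].
rewrite -raddf_sum -mulr_sumr /re_pminor.
transitivity (complex.Re (k * (- (#|S| * (n - #|S|).+1)%:R *
    pminor S (V *m complexify x)))).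
  congr (complex.Re (k * _)); rewrite -casimir_pminor.
  apply: eq_bigr => j _; apply: eq_bigr => s _; congr (_ * _).
  by rewrite realifyK !mulmxA.
have ReZ (a : R) z : complex.Re (a%:C * z) = a * complex.Re z.
  by case: z => p q /=; rewrite mul0r subr0.
by rewrite -ReZ mulrCA rmorphN rmorph_nat.
Qed.

End Laplacian.

(** * Expectation of a bounded eigenfunction along the Brownian motion *)

Section Expectation.
Variables (R : realType) (d : measure_display) (Omega : measurableType d).
Variables (P : probability Omega R) (n : nat).
Variable U : R -> Omega -> 'M[R[i]]_n.
Hypothesis U_bm : unitary_brownian_motion P U.
Hypothesis U_start : forall w, U 0 w = 1%:M.
Variables (f : ambient R n -> R) (c C : R).
Hypothesis f_smooth : smooth f.
Hypothesis f_eigen : forall M, M \is unitarymx ->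
  laplace_beltrami f (realify M) = c * f (realify M).
Hypothesis f_bounded : forall M, M \is unitarymx -> `|f (realify M)| <= C.

Local Notation mu := (@lebesgue_measure R).
Let X (t : R) (w : Omega) : R := f (realify (U t w)).

Lemma path_integrable (t : R) : 0 <= t ->
  P.-integrable [set: Omega] (fun w => (f (realify (U t w)))%:E).
Proof.
move=> t0; apply: measurable_bounded_integrable => //.
- exact: le_lt_trans (probability_le1 _ measurableT) (ltry _).
- apply: (measurability _ (measurable_realfun.RGenOpens.measurableE R)).
  move=> _ [_ [a [b ->] <-]]; rewrite setTI.
  apply: (ubm_measurable U_bm (O := f @^-1` `]a, b[%classic)) => //.
  by apply: open_comp (interval_open _ _) => // x _; exact: (f_smooth 0).
- exists C; split; first by rewrite num_real.
  by move=> y Cy w _; exact: le_trans (f_bounded (ubm_unitary U_bm w t0)) (ltW Cy).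
Qed.

Let X_integrable (t : R) : 0 <= t -> P.-integrable [set: Omega] (EFin \o X t).
Proof. exact: path_integrable. Qed.

(** The drift, frozen at its time 0 value for negative times: paths are continuous on nonnegative
    times only, and this extension is continuous on the whole line. *)
Let q w (s : R) : R := c / 2 * X (Num.max s 0) w.

Let q_continuous w : continuous (q w).
Proof.
move=> s; apply: cvgM; first exact: cvg_cst.
have /subspace_continuousP/(_ (Num.max s 0)) :=
  @ubm_continuous _ _ _ _ _ _ U_bm w.
have s0 : 0 <= Num.max s 0 by rewrite le_max lexx orbT.
move=> /(_ s0) Uc.
have mc : Num.max s' 0 @[s' --> s] --> Num.max s 0.
  apply: (@continuous_max _ _ id (fun=> 0)); first exact: cvg_id.
  exact: cvg_cst.
(* The truncated time never leaves the nonnegative half-line, so its limit also holds for the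
   restricted filter, where continuity of the path applies. *)
have mcw : Num.max s' 0 @[s' --> s] -->
    within [set t : R | 0 <= t] (nbhs (Num.max s 0)).
  move=> B wB.
  have h : nbhs s [set s' | 0 <= Num.max s' 0 -> B (Num.max s' 0)] := mc _ wB.
  change (nbhs s [set s' | B (Num.max s' 0)]).
  by apply: filterS h => s' /=; apply; rewrite le_max lexx orbT.
have mUc := cvg_comp _ _ mcw Uc.
exact: (cvg_comp _ _ mUc (f_smooth 0 _)).
Qed.

Let q_integrable w a b : mu.-integrable `[a, b] (EFin \o q w).
Proof.
apply: continuous_compact_integrable; first exact: segment_compact.
by apply: continuous_subspaceT => x; exact: q_continuous.
Qed.

Let q_bounded w s : `|q w s| <= `|c / 2| * C.
Proof.
rewrite normrM ler_wpM2l // f_bounded // (ubm_unitary U_bm) //.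
by rewrite le_max lexx orbT.
Qed.

(* Starting the integral at -1 makes t = 0 an interior point, so that
   differentiation under the expectation gives two-sided derivatives there. *)
Let J (t : R) (w : Omega) : R := \int[mu]_(s in `[-1, t]) q w s.

Let J_derive (t : R) (w : Omega) : -1 < t -> is_derive t 1 (J ^~ w) (q w t).
Proof.
move=> t1; have tt : t < t + 1 by rewrite ltrDl.
have [dJ JE] := continuous_FTC1_closed tt (q_integrable w (-1) _) t1 (@q_continuous w t).
split; first exact: dJ.
by rewrite -derive1E.
Qed.

(** Up to time 0 the integrand is the deterministic value at the identity. *)
Let J_neg (t : R) : t <= 0 -> exists k, J t = cst k.
Proof.
move=> t0; exists (\int[mu]_(s in `[-1, t]) (c / 2 * f (realify 1%:M))).
apply/funext => w; apply: eq_Rintegral => s; rewrite inE /= in_itv /= => /andP[_ st].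
by rewrite /q /X max_r ?U_start // (le_trans st).
Qed.

Let M := dynkin_process U f.

(** The definition of the Dynkin process solved for its time integral, the eigenvalue equation
    having replaced the Laplacian by [c] times [f]. *)
Let J_pos (t : R) (w : Omega) : 0 <= t -> J t w = J 0 w + (X t w - X 0 w - M t w).
Proof.
move=> t0; rewrite /M /dynkin_process subKr.
have -> : \int[mu]_(s in `[0, t]) (2^-1 * laplace_beltrami f (realify (U s w))) =
    \int[mu]_(s in `[0, t]) q w s.
  apply: eq_Rintegral => s; rewrite inE /= in_itv /= => /andP[s0 _].
  rewrite f_eigen ?(ubm_unitary U_bm) // /q /X max_l //.
  by ring.
have iq : mu.-integrable `]0, t] (EFin \o q w).
  apply: integrableS (q_integrable w 0 t) => //.
  by apply: subset_itvr; rewrite bnd_simp.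
have -> : \int[mu]_(s in `[0, t]) q w s = J t w - J 0 w.
  rewrite -(Rintegral_itv_obnd_cbnd iq).
  rewrite -(Rintegral_itvB (q_integrable w (-1) t)) // bnd_simp.
  by rewrite lerN10.
by rewrite addrC subrK.
Qed.

Let M_martingale : martingale P (natural_filtration U) M.
Proof. exact: ubm_martingale. Qed.

Let M_integrable (t : R) : 0 <= t -> P.-integrable [set: Omega] (EFin \o M t).
Proof. by case: M_martingale => _ + _; apply. Qed.

Let M_mean (t : R) : 0 <= t -> \int[P]_w M t w = 0.
Proof.
move=> t0; case: M_martingale => _ _ /(_ 0 t setT) -> //.
  rewrite (_ : M 0 = cst 0) ?Rintegral_cst ?mul0r //.
  apply/funext => w; rewrite /M /dynkin_process subrr sub0r.
  by rewrite set_itv1 Rintegral_set1 oppr0.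
(* The martingale identity between times 0 and [t] is used on the whole space, which lies in the
   initial sigma-algebra. *)
rewrite -[setT]setC0 -setTD; apply: sigma_algebraCD; exact: sigma_algebra0.
Qed.

(** Read off from [X] and [M] through [J_pos], which avoids joint measurability in time and [w]. *)
Let J_integrable (t : R) : P.-integrable [set: Omega] (EFin \o J t).
Proof.
have [t0|t0] := leP t 0.
  have [k ->] := J_neg t0; exact: finite_measure_integrable_cst.
have [k J0] := J_neg (lexx 0).
have -> : EFin \o J t =
  (fun w => (EFin \o cst k) w + ((EFin \o X t) w - (EFin \o X 0) w - (EFin \o M t) w))%E.
  by apply/funext => w /=; rewrite J_pos ?(ltW t0) // J0.
apply: integrableD => //; first exact: finite_measure_integrable_cst.
apply: integrableB => //; last by apply: M_integrable; exact: ltW.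
by apply: integrableB => //; apply: X_integrable => //; exact: ltW.
Qed.

Let F (t : R) : R := \int[P]_w J t w.

Let X_mean (t : R) : 0 <= t -> \int[P]_w X t w = F t - F 0 + f (realify 1%:M).
Proof.
move=> t0; have [k J0] := J_neg (lexx 0).
have P1 : fine (P [set: Omega]) = 1 by rewrite (probability_setT P).
have -> : F 0 = k by rewrite /F J0 Rintegral_cst // P1 mulr1.
have XE : X 0 = cst (f (realify 1%:M)).
  by apply/funext => w; rewrite /X U_start.
pose r := k - f (realify 1%:M).
have -> : F t = \int[P]_w (r + (X t w - M t w)).
  apply: eq_Rintegral => w _; rewrite J_pos // J0 XE /= /r.
  by ring.
have iX := X_integrable t0; have iM := M_integrable t0.
have iXM : P.-integrable [set: Omega] (EFin \o (fun w => X t w - M t w)).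
  have -> : EFin \o (fun w => X t w - M t w) =
    (fun w => (EFin \o X t) w - (EFin \o M t) w)%E by apply/funext.
  exact: integrableB.
rewrite RintegralD //; last exact: (finite_measure_integrable_cst _ r).
rewrite (RintegralB _ iX iM) // M_mean // Rintegral_cst // P1 /r.
by ring.
Qed.

(** Differentiation under the expectation, dominated by the constant bound on [q]. Together with
    [X_mean] it closes into a linear differential equation. *)
Let F_derive (t : R) : 0 <= t -> is_derive t 1 F (c / 2 * \int[P]_w X t w).
Proof.
move=> t0.
have tI : `]-1, t + 1[%classic t.
  by rewrite /= in_itv /= (lt_le_trans _ t0) ?ltrN10 // ltrDl ltr01.
have p1 s w : -1 < s -> partial1of2 J s w = q w s.
  by move=> s1; rewrite partial1of2E; have [_] := J_derive w s1.
have Fl : h^-1 *: (F (h + t) - F t) @[h --> 0^'] -->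
    c / 2 * \int[P]_w X t w.
  have -> : c / 2 * \int[P]_w X t w = \int[P]_w partial1of2 J t w.
    rewrite -RintegralZl //; last exact: X_integrable.
    apply: eq_Rintegral => w _; rewrite p1 /q ?max_l //.
    by rewrite (lt_le_trans _ t0) ?ltrN10.
  have dJ s w : `]-1, t + 1[%classic s -> [set: Omega] w ->
      derivable (J ^~ w) s 1.
    by rewrite /= in_itv /= => /andP[s1 _] _; have [] := J_derive w s1.
  pose G (w : Omega) : R := `|c / 2| * C.
  have G0 w : 0 <= G w by exact: le_trans (normr_ge0 _) (q_bounded w 0).
  have iG : P.-integrable [set: Omega] (EFin \o G).
    exact: (finite_measure_integrable_cst P (`|c / 2| * C)).
  have dG s w : `]-1, t + 1[%classic s -> [set: Omega] w ->
      `|partial1of2 J s w| <= G w.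
    by rewrite /= in_itv /= => /andP[s1 _] _; rewrite p1.
  exact: (cvg_differentiation_under_integral measurableT tI
    (fun s _ => J_integrable s) dJ G0 iG dG).
have e : (fun h => h^-1 *: ((F \o shift t) (h *: 1) - F t)) =
    (fun h => h^-1 *: (F (h + t) - F t)).
  by apply/funext => h /=; rewrite [h *: 1]mulr1.
split; first by apply/cvg_ex; exists (c / 2 * \int[P]_w X t w); rewrite e.
by rewrite /derive e; exact/cvg_lim.
Qed.

Lemma mean_eigenfunction (t : R) : 0 <= t ->
  \int[P]_w f (realify (U t w)) = f (realify 1%:M) * expR (c / 2 * t).
Proof.
pose e s := F s - F 0 + f (realify 1%:M).
(* Integrating factor: [e] satisfies [e' = c / 2 * e], so [h] has zero derivative and is constant by
   the mean value theorem. *)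
pose h s := e s * expR (- (c / 2) * s).
have h_derive (s : R) : 0 <= s -> is_derive s 1 h 0.
  move=> s0; have es : is_derive s 1 e (c / 2 * e s).
    have Fs := F_derive s0.
    have d1 := is_deriveB Fs (is_derive_cst (F 0) s 1).
    have d2 := is_deriveD d1 (is_derive_cst (f (realify 1%:M)) s 1).
    by apply: is_derive_eq d2 _; rewrite subr0 addr0 (X_mean s0).
  have xs : is_derive s 1 (fun s => expR (- (c / 2) * s))
      (expR (- (c / 2) * s) * - (c / 2)).
    apply: (@is_derive1_comp _ expR (fun s => - (c / 2) * s)).
    by apply: is_derive_eq; rewrite /GRing.scale /=; ring.
  apply: is_derive_eq (is_deriveM es xs) _; rewrite /GRing.scale /=.
  by ring.
rewrite le_eqVlt => /predU1P[<-|t0].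
  rewrite X_mean // subrr add0r mulr0 expR0 mulr1 //.
have [||s _] := @MVT _ h (cst 0) 0 t t0.
- by move=> s; rewrite in_itv /= => /andP[/ltW s0 _]; exact: h_derive.
- apply: derivable_within_continuous => s; rewrite in_itv /= => /andP[s0 _].
  by have [] := h_derive s s0.
have h0 : h 0 = f (realify 1%:M).
  by rewrite /h /e subrr add0r mulr0 expR0 mulr1.
rewrite mul0r h0 => /eqP; rewrite subr_eq0 => /eqP ht.
rewrite X_mean ?ltW // -/(e t) -ht /h -mulrA -expRD.
by rewrite mulNr addNr expR0 mulr1.
Qed.

End Expectation.

(** * Derivatives in z of polynomials and in t of sums of exponentials *)

Section Derivatives.

Lemma is_derive_horner (K : numFieldType) (p : {poly K}) (x : K^o) :
  is_derive x (1 : K^o) (horner p : K^o -> K^o) p^`().[x].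
Proof.
elim/poly_ind: p => [|p r ih].
  rewrite deriv0 horner0.
  have -> : horner (0 : {poly K}) = cst 0 by apply/funext => y; rewrite horner0.
  exact: is_derive_cst.
have -> : (horner (p * 'X + r%:P) : K^o -> K^o) =
    ((horner p : K^o -> K^o) * id) + cst r.
  by apply/funext => y; rewrite !hornerE.
apply: is_derive_eq; rewrite derivD derivC addr0 derivM derivX !hornerE.
by rewrite /GRing.scale /= mulr1 addrC mulrC.
Qed.

Variable R : realType.

Lemma euler_op_horner (p : {poly R[i]}) :
  euler_op (horner p) = horner ('X * p^`()).
Proof.
apply/funext => z; rewrite /euler_op derive1E.
by rewrite (derive_val (is_derive := is_derive_horner p z)) !hornerE.
Qed.

Lemma cvg_real_complex (T : Type) (F : set_system T) (FF : Filter F)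
    (f : T -> R) (l : R) :
  f @ F --> l -> ((fun x => (f x)%:C : R[i]^o) @ F --> (l%:C : R[i]^o)).
Proof.
move=> fl; apply/(@cvgrPdist_lt _ R[i]^o) => e e0.
(* The norm of [R[i]] takes values in [R[i]], where a positive radius is necessarily real. *)
have eE : e = (complex.Re e)%:C.
  by rewrite RRe_real // gtr0_real.
have re0 : 0 < complex.Re e by rewrite -ltcR -eE.
move/cvgrPdist_lt : fl => /(_ _ re0); apply: filterS => x.
rewrite eE -rmorphB /= normc_def /= expr0n /= addr0 sqrtr_sqr.
by rewrite ltcR.
Qed.

End Derivatives.

Section NonnegDerivative.
Variable R : realType.

Lemma cvg_expR_slope (r t : R) :
  h^-1 * (expR (r * (t + h)) - expR (r * t)) @[h --> 0^'] --> r * expR (r * t).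
Proof.
have d : is_derive t 1 (fun s : R => expR (r * s)) (expR (r * t) * r).
  apply: (@is_derive1_comp _ expR (fun s => r * s)).
  by apply: is_derive_eq; rewrite /GRing.scale /=; ring.
have e : (fun h : R => h^-1 *: (((fun s => expR (r * s)) \o shift t) (h *: (1 : R))
      - expR (r * t))) = (fun h => h^-1 * (expR (r * (t + h)) - expR (r * t))).
  by apply/funext => h; rewrite /GRing.scale /= mulr1 (addrC h).
have [] := d; rewrite /derivable /derive e => dd dv.
by rewrite [r * expR _]mulrC -dv; exact: dd.
Qed.

(** The exponential sum has a two-sided derivative. On the increments with [0 <= t + h] its
    difference quotient is that of [f], so the restricted limit is the same. *)
Lemma is_derive_nonneg_exp_sum (m : nat) (B : 'I_m -> R[i]) (r : 'I_m -> R)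
    (f : R -> R[i]) (t : R) :
  (forall s, 0 <= s -> f s = \sum_j B j * (expR (r j * s))%:C) -> 0 <= t ->
  is_derive_nonneg f t (\sum_j B j * (r j * expR (r j * t))%:C).
Proof.
move=> fE t0; rewrite /is_derive_nonneg.
pose g h : R[i]^o := \sum_j
  B j * (h^-1 * (expR (r j * (t + h)) - expR (r j * t)))%:C.
have gl : g @ 0^' --> (\sum_j B j * (r j * expR (r j * t))%:C : R[i]^o).
  apply: cvg_big => [|j _]; first exact: add_continuous.
  apply: (@cvgZl_tmp R[i] R[i]^o).
  exact: (cvg_real_complex _ (@cvg_expR_slope (r j) t)).
refine (cvg_trans _ (@cvg_within_filter _ _ _ _ _ _ [set h | 0 <= t + h] gl)).
apply: near_eq_cvg.
rewrite near_withinE; apply: nearW => h /= th.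
rewrite /g !fE // -sumrB mulr_sumr; apply: eq_bigr => j _.
by rewrite -mulrBr -rmorphB mulrCA -rmorphM.
Qed.

End NonnegDerivative.

(** * Boundedness of minors on the unitary group *)

Section PminorBounds.
Local Open Scope sesquilinear_scope.
Variables (R : realType) (n : nat).

Lemma unitarymx_entry_le1 (M : 'M[R[i]]_n) (i j : 'I_n) :
  M \is unitarymx -> `|M i j| <= 1.
Proof.
move=> /unitarymxP/matrixP/(_ i i); rewrite !mxE eqxx => MM.
have : `|M i j| ^+ 2 <= 1.
  rewrite -[leRHS]/(true%:R) -MM (bigD1 j) //= !mxE -normCK lerDl.
  by apply: sumr_ge0 => k _; rewrite !mxE -normCK exprn_ge0.
by rewrite expr_le1.
Qed.

(** There are at most n! Leibniz terms, each a product of entries of modulus at most 1. *)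
Lemma normr_pminor_unitary (M : 'M[R[i]]_n) (S : {set 'I_n}) :
  M \is unitarymx -> `|pminor S M| <= n`!%:R.
Proof.
move=> Mu; apply: (le_trans (ler_norm_sum _ _ _)).
apply: (@le_trans _ _ (\sum_(s : 'S_n | perm_on S s) 1)).
  apply: ler_sum => s _; rewrite normrM normrX normrN normr1 expr1n mul1r.
  rewrite normr_prod; apply: prodr_ile1 => i _.
  by rewrite normr_ge0 unitarymx_entry_le1.
rewrite sumr_const ler_nat -(card_Sn n); exact: max_card.
Qed.

Lemma re_pminor_bounded (k : R[i]) (V M : 'M[R[i]]_n) (S : {set 'I_n}) :
  V \is unitarymx -> M \is unitarymx ->
  `|re_pminor k V S (realify M)| <= complex.Re (`|k| * n`!%:R).
Proof.
move=> Vu Mu; rewrite /re_pminor realifyK.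
have : (`|complex.Re (k * pminor S (V *m M))|)%:C <= `|k| * n`!%:R.
  apply: (le_trans (normc_ge_Re _)); rewrite normrM ler_wpM2l //.
  exact: normr_pminor_unitary (mul_unitarymx Vu Mu).
by rewrite lecE => /andP[_].
Qed.

End PminorBounds.

Lemma Rintegral_sum (R : realType) (d : measure_display) (T : measurableType d)
    (mu : {measure set T -> \bar R}) (D : set T) (I : Type) (r : seq I)
    (g : I -> T -> R) : measurable D ->
  (forall i, mu.-integrable D (fun x => (g i x)%:E)) ->
  \int[mu]_(x in D) (\sum_(i <- r) g i x) =
  \sum_(i <- r) \int[mu]_(x in D) g i x.
Proof.
move=> mD ig; elim: r => [|i r ih].
  rewrite big_nil; under eq_Rintegral do rewrite big_nil.
  by rewrite Rintegral_cst // mul0r.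
rewrite big_cons -ih; under eq_Rintegral do rewrite big_cons.
rewrite RintegralD //; first exact: ig.
rewrite (_ : EFin \o _ = (fun x => \sum_(j <- r) (g j x)%:E)%E); last first.
  by apply/funext => x; rewrite /= sumEFin.
exact: integrable_sum.
Qed.

(** * Coefficients of the characteristic polynomial as sums of principal minors *)

Section CharPoly.
Variables (T : comNzRingType) (n : nat) (V : 'M[T]_n).

Lemma char_poly_pminor : char_poly V =
  \sum_(S : {set 'I_n}) ((-1) ^+ #|S| * pminor S V) *: 'X^(n - #|S|).
Proof.
rewrite /char_poly /char_poly_mx det_scalar_sub; apply: eq_bigr => S _.
have -> : pminor S (map_mx polyC V) = (pminor S V)%:P.
  rewrite /pminor rmorph_sum; apply: eq_bigr => s _.
  rewrite rmorphM rmorphXn rmorphN1 rmorph_prod; congr (_ * _).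
  by apply: eq_bigr => i _; rewrite mxE.
by rewrite -mul_polyC polyCM rmorphXn rmorphN1 mulrAC.
Qed.

(** The weight [u] sees only the size of [S], so grouping the subsets by [n - #|S|] collects the
    minors into coefficients. *)
Lemma sum_pminor_char_poly (z : T) (u : nat -> T) :
  \sum_(S : {set 'I_n})
     (-1) ^+ #|S| * z ^+ (n - #|S|) * pminor S V * u (n - #|S|)%N =
  \sum_(j < n.+1) (char_poly V)`_j * u j * z ^+ j.
Proof.
rewrite (partition_big (fun S : {set 'I_n} => inord (n - #|S|) : 'I_n.+1) xpredT) //=.
apply: eq_bigr => j _; rewrite char_poly_pminor coef_sum !mulr_suml.
rewrite [RHS](bigID (fun S : {set 'I_n} => inord (n - #|S|) == j)) /=.
have inE (S : {set 'I_n}) : nat_of_ord (inord (n - #|S|) : 'I_n.+1) = (n - #|S|)%N.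
  by rewrite inordK // ltnS leq_subr.
rewrite [X in _ = _ + X]big1 ?addr0; last first.
  move=> S; rewrite -val_eqE /= inE => /negPf nj.
  by rewrite coefZ coefXn eq_sym nj mulr0 !mul0r.
apply: eq_bigr => S; rewrite -val_eqE /= inE => /eqP <-.
rewrite coefZ coefXn eqxx mulr1.
by rewrite -!mulrA; congr (_ * _); rewrite mulrC !mulrA.
Qed.

End CharPoly.

Lemma coef_comp_scaleX (T : comNzRingType) (p : {poly T}) (c : T) (j : nat) :
  (p \Po (c *: 'X))`_j = p`_j * c ^+ j.
Proof.
rewrite coef_comp_poly.
under eq_bigr => i _ do rewrite exprZn coefZ coefXn.
have [jp|jp] := ltnP j (size p).
  rewrite (bigD1 (Ordinal jp)) //= eqxx mulr1 big1 ?addr0 // => i.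
  by rewrite -val_eqE /= eq_sym => /negPf ->; rewrite !mulr0.
rewrite nth_default // mul0r big1 // => i _.
by rewrite gtn_eqF ?mulr0 // (leq_trans (ltn_ord i)).
Qed.

(** Half the eigenvalue of the minors of size [n - j], which make up the coefficient of [z ^+ j]. *)
Definition decay_rate (R : realType) (n j : nat) : R := - ((n - j) * j.+1)%:R / 2.

(** * The mean determinant as a sum of decaying monomials *)

Section MeanDet.
Variables (R : realType) (d : measure_display) (Omega : measurableType d).
Variables (P : probability Omega R) (n : nat).
Variables (U : R -> Omega -> 'M[R[i]]_n) (V : 'M[R[i]]_n).
Hypothesis U_bm : unitary_brownian_motion P U.
Hypothesis U_start : forall w, U 0 w = 1%:M.
Hypothesis V_unitary : V \is unitarymx.

Lemma mean_re_pminor (k : R[i]) (S : {set 'I_n}) (t : R) : 0 <= t ->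
  P.-integrable [set: Omega] (fun w => (re_pminor k V S (realify (U t w)))%:E) /\
  \int[P]_w re_pminor k V S (realify (U t w)) =
  complex.Re (k * pminor S V * (expR (decay_rate R n (n - #|S|) * t))%:C).
Proof.
move=> t0.
have bd M := @re_pminor_bounded R n k V M S V_unitary.
have sm := re_pminor_smooth k V S.
split; first exact: (path_integrable U_bm sm bd).
have eig (M : 'M[R[i]]_n) : M \is unitarymx ->
    laplace_beltrami (re_pminor k V S) (realify M) =
    - (#|S| * (n - #|S|).+1)%:R * re_pminor k V S (realify M).
  by move=> Mu; apply: laplace_beltrami_re_pminor; rewrite realifyK.
rewrite (mean_eigenfunction U_bm U_start sm eig bd) //.
have Sn : (#|S| <= n)%N by rewrite -[n in (_ <= n)%N]card_ord max_card.
rewrite /decay_rate subKn // /re_pminor realifyK mulmx1.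
by rewrite [RHS]complex_ReM /= mulr0 subr0.
Qed.

Lemma mean_re_det (k z : R[i]) (t : R) : 0 <= t ->
  \int[P]_w complex.Re (k * \det (z%:M - V *m U t w)) =
  complex.Re (k * \sum_(j < n.+1)
    (char_poly V)`_j * (expR (decay_rate R n j * t))%:C * z ^+ j).
Proof.
move=> t0; pose a (S : {set 'I_n}) : R[i] := (-1) ^+ #|S| * z ^+ (n - #|S|).
rewrite (@eq_Rintegral _ _ _ P _ (fun w =>
    \sum_S re_pminor (k * a S) V S (realify (U t w)))); last first.
  move=> w _; rewrite det_scalar_sub mulr_sumr raddf_sum; apply: eq_bigr => S _.
  by rewrite /re_pminor realifyK /a !mulrA.
rewrite Rintegral_sum //; last by move=> S; have [] := mean_re_pminor (k * a S) S t0.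
rewrite -(sum_pminor_char_poly V z (fun j => (expR (decay_rate R n j * t))%:C)).
rewrite mulr_sumr raddf_sum; apply: eq_bigr => S _.
by have [_ ->] := mean_re_pminor (k * a S) S t0; rewrite /a !mulrA.
Qed.

Lemma mean_detE (z : R[i]) (t : R) : 0 <= t ->
  mean_det P V U z t = \sum_(j < n.+1)
    (char_poly V)`_j * (expR (decay_rate R n j * t))%:C * z ^+ j.
Proof.
move=> t0; rewrite /mean_det /complex_expectation unlock.
set s := \sum_(j < _) _.
(* Both parts of the expectation come from [mean_re_det], with [k = 1] and [k = - 'i]. *)
have ImE (w : R[i]) : complex.Im w = complex.Re (- 'i * w).
  by case: w => x y /=; ring.
have -> : s = complex.Re (1 * s) +i* complex.Re (- 'i * s).
  by rewrite mul1r -ImE; case: s.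
rewrite -!mean_re_det // /Rintegral; congr (fine _ +i* fine _).
  by apply: eq_integral => w _; rewrite mul1r.
by apply: eq_integral => w _; rewrite -ImE.
Qed.

End MeanDet.

(** * The Hermite side, and the assembly of the formula and the PDE *)

Lemma coef_hermite_rescaled (R : realType) (n j : nat) (t : R) : (j <= n)%N ->
  (hermite_rescaled n t)`_j =
  (-1) ^+ (n - j) * 'C(n, j)%:R * (expR (decay_rate R n j * t))%:C.
Proof.
move=> jn; rewrite /hermite_rescaled coefZ coef_comp_scaleX coef_poly ltnS jn.
rewrite -rmorphXn mulrA mulrCA -!mulrA; congr (_ * (_ * _)).
rewrite mulrCA -!rmorphM -expRM_natl -!expRD; congr (expR _)%:C.
rewrite /decay_rate natrM -[j.+1]addn1 natrD natrB //.
by field.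
Qed.

(** The binomial of the Hermite coefficient cancels the one in the convolution, and the two signs
    square to 1. *)
Lemma horner_free_mul_conv_hermite (R : realType) (n : nat) (t : R)
    (p : {poly R[i]}) (z : R[i]) :
  (free_mul_conv n p (hermite_rescaled n t)).[z] =
  \sum_(j < n.+1) p`_j * (expR (decay_rate R n j * t))%:C * z ^+ j.
Proof.
rewrite horner_poly; apply: eq_bigr => j _; congr (_ * _).
have jn : (j <= n)%N by rewrite -ltnS.
rewrite coef_hermite_rescaled // -mulrA mulrCA; congr (_ * _).
have C0 : 'C(n, j)%:R != 0 :> R[i] by rewrite pnatr_eq0 -lt0n bin_gt0.
rewrite [_ * _ * (expR _)%:C]mulrAC mulfK // mulrA.
by rewrite -exprD addnn -mul2n exprM sqrrN !expr1n mul1r.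
Qed.

Theorem corollary2p11 (R : realType) (d : measure_display)
    (Omega : measurableType d) (P : probability Omega R) (n : nat)
    (U : R -> Omega -> 'M[R[i]]_n) (V : 'M[R[i]]_n)
    (n_gt0 : (0 < n)%N)
    (U_bm : unitary_brownian_motion P U)
    (U_start : forall w, U 0 w = 1%:M)
    (V_unitary : V \is unitarymx) :
  let Q := mean_det P V U in
  [/\ forall (t : R) (z : R[i]), 0 <= t ->
        Q z t = (free_mul_conv n (char_poly V) (hermite_rescaled n t)).[z],
      forall (t : R) (z : R[i]), 0 <= t ->
        is_derive_nonneg (Q z) t
          (let g := fun x => n%:R * Q x t - euler_op (Q ^~ t) x in
           - 2^-1 * (euler_op g z + g z)) &
      forall z : R[i], Q z 0 = \det (z%:M - V)].
Proof.
move=> Q.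
have QE t z : 0 <= t -> Q z t = \sum_(j < n.+1)
    (char_poly V)`_j * (expR (decay_rate R n j * t))%:C * z ^+ j.
  exact: mean_detE.
split=> [t z t0|t z t0|z].
- by rewrite QE // horner_free_mul_conv_hermite.
- pose q := \poly_(j < n.+1) ((char_poly V)`_j * (expR (decay_rate R n j * t))%:C).
  have qE : Q ^~ t = horner q by apply/funext => x; rewrite QE // horner_poly.
  (* At fixed [t] the function is a polynomial [q], so Euler operators become polynomial operations;
     [r] is the inner factor of the PDE applied to [q]. *)
  pose r := n%:R *: q - 'X * q^`().
  have -> : (fun x => n%:R * Q x t - euler_op (Q ^~ t) x) = horner r.
    apply/funext => x; rewrite qE euler_op_horner /r hornerD hornerN hornerZ.
    by rewrite -[Q x t]/((Q ^~ t) x) qE.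
  rewrite /= euler_op_horner -hornerD -hornerZ.
  (* The operator is diagonal on monomials: on ['X^j] it acts by [- (j + 1) (n - j) / 2], which is
     [decay_rate R n j]. *)
  have -> : - 2^-1 *: ('X * r^`() + r) =
      \poly_(j < n.+1) ((char_poly V)`_j *
         (decay_rate R n j * expR (decay_rate R n j * t))%:C).
    apply/polyP => j; rewrite coefZ coefD coefXM coef_deriv.
    have rj : r`_j = (n%:R - j%:R) * q`_j.
      rewrite /r coefB coefZ coefXM coef_deriv mulrBl.
      by case: j => [|j]; rewrite ?mul0r !mulr_natl.
    have -> : (if j == 0%N then 0 else r`_j.-1.+1 *+ j.-1.+1) = j%:R * r`_j.
      by case: j {rj} => [|j]; rewrite ?mul0r ?mulr_natl.
    rewrite rj /q !coef_poly; case: ltnP => [jn|_]; last by rewrite !mulr0 addr0 mulr0.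
    rewrite /decay_rate natrM -[j.+1]addn1 natrD natrB // !rmorphM.
    rewrite rmorphN rmorphM rmorphB rmorphD !rmorph_nat fmorphV rmorph_nat.
    by ring.
  rewrite horner_poly.
  have := @is_derive_nonneg_exp_sum R n.+1
    (fun j => (char_poly V)`_j * z ^+ j) (fun j => decay_rate R n j) (Q z) t.
  under [in X in _ -> _ -> is_derive_nonneg _ _ X]eq_bigr => j _ do rewrite mulrAC.
  apply=> // s s0; rewrite QE //; apply: eq_bigr => j _.
  by rewrite mulrAC.
- rewrite QE // det_scalar_sub.
  (* At time 0 all exponentials are 1, and the sum regroups into the expansion of the determinant
     with the constant weight 1. *)
  transitivity (\sum_(j < n.+1) (char_poly V)`_j * 1 * z ^+ j).
    by apply: eq_bigr => j _; rewrite mulr0 expR0.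
  rewrite -(sum_pminor_char_poly V z (fun=> 1)).
  by apply: eq_bigr => S _; rewrite mulr1.
Qed.
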